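(* Let $n\ge 2$, let $p$ be a prime, and let $\mathsf y\in\mathfrak{gl}_n(\mathbb F_p)$. If $\mathsf y$ fixes exactly $k$ one-dimensional subspaces of $\mathbb F_p^n$ (that is, exactly $k$ one-dimensional subspaces $V$ satisfy $\mathsf yV\subseteq V$), then $$\left|\mathcal B_p(\mathsf y,\bar H(\mathbf m_{\mathbf{max}}))\right|=[n-2]_p!\left([n]_p[n-2]_p+kp^{n-2}\right).$$
   Context: $\mathbf m_{\mathbf{max}}=(n-1,n,\dots,n)$ (length $n$), and $\bar H(\mathbf m_{\mathbf{max}})$ is the space of matrices $\mathsf a\in\mathfrak{gl}_n(\mathbb F_p)$ with $\mathsf a_{n1}=0$. Let $\bar G=GL_n(\mathbb F_p)$ and let $\bar B$ be its subgroup of upper triangular matrices. Then $\mathcal B_p(\mathsf y,\bar H(\mathbf m_{\mathbf{max}}))=\{g\bar B\in\bar G/\bar B\mid g^{-1}\mathsf yg\in\bar H(\mathbf m_{\mathbf{max}})\}$; equivalently, it is the set of full flags $0=V_0\subset V_1\subset\cdots\subset V_n=\mathbb F_p^n$ with $\mathsf yV_1\subseteq V_{n-1}$. $[m]_t=\sum_{j=0}^{m-1}t^j$ (so $[0]_t=0$) and $[m]_t!=\prod_{j=1}^m[j]_t$ (so $[0]_t!=1$). *)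

(* Defs.v *)
From HB Require Import structures.
From mathcomp Require Import all_boot all_order all_fingroup all_algebra.

Set Implicit Arguments.
Unset Strict Implicit.
Unset Printing Implicit Defensive.

Import GRing.Theory.
Local Open Scope ring_scope.

(* MathComp realizes GL_n over F as the units of 'M[F]_n.-1.+1, a dimension    *)
(* which is n as soon as 0 < n; all the matrices and vectors below are given   *)
(* that dimension, so that these definitions are meaningful only for 0 < n.    *)
(* Matrices act on column vectors.                                             *)

Section HessenbergVariety.

Variables (F : finFieldType) (n : nat).

(* [is_trig_mx] means lower triangular, hence the transpose. *)
Definition borel : {set {'GL_n[F]}} := [set g | is_trig_mx (GLval g)^T].

Lemma borel_group_set : group_set borel.
Proof.
apply/group_setP; split=> [|g h].
  by rewrite inE GL_1E tr_scalar_mx scalar_mx_is_trig.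
rewrite !inE => /is_trig_mxP gT /is_trig_mxP hT.
apply/is_trig_mxP => i j lt_ij; rewrite GL_MxE mxE mxE big1 // => l _.
case: (ltnP i l) => [lt_il | le_li].
  by have := hT i l lt_il; rewrite mxE => ->; rewrite mulr0.
by have := gT l j (leq_ltn_trans le_li lt_ij); rewrite mxE => ->; rewrite mul0r.
Qed.

Canonical borel_group := Group borel_group_set.

(* For m_max = (n-1, n, ..., n), the only condition is on the lower left entry. *)
Definition Hess_max : {pred 'M[F]_n.-1.+1} :=
  [pred a : 'M[F]_n.-1.+1 | a ord_max ord0 == 0].

(* Elements of G / B are left cosets g B, represented as subsets of G. *)
Definition Hess_variety (y : 'M[F]_n.-1.+1) (H : {pred 'M[F]_n.-1.+1}) :
    {set {set {'GL_n[F]}}} :=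
  [set (g *: borel)%g | g in 'GL_n[F]%g
                      & invmx (GLval g) *m y *m GLval g \in H].

Definition fixed_line (y : 'M[F]_n.-1.+1) : {pred {vspace 'cV[F]_n.-1.+1}} :=
  [pred V | (\dim V == 1%N) && (linfun (mulmx y) @: V <= V)%VS].

(* The type {vspace _} carries no finType structure, so #|_| is unavailable. *)
Definition fixes_exactly (y : 'M[F]_n.-1.+1) (k : nat) : Prop :=
  exists s : seq {vspace 'cV[F]_n.-1.+1},
    [/\ uniq s, size s = k & s =i fixed_line y].

End HessenbergVariety.

Definition qint (m t : nat) : nat := (\sum_(0 <= j < m) t ^ j)%N.

Definition qfact (m t : nat) : nat := (\prod_(1 <= j < m.+1) qint j t)%N.

(* Main.v *)
Require Import Defs.
From mathcomp Require Import all_boot all_order all_fingroup all_algebra.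
From mathcomp Require Import mxabelem ring.

(** Write [q] for the cardinal of the field.  The number of flags is the number
    of invertible matrices [g] satisfying the Hessenberg condition divided by
    the order of the Borel subgroup, since that condition is invariant under
    right translation by upper triangular matrices.

    The lower left entry of [g^-1 y g] only depends on the first column [v] of
    [g] and on the last row [w] of [g^-1]: it is [w y v].  In terms of flags,
    [v] spans the line [V_1] and [w] is an equation of the hyperplane
    [V_(n-1)].  The pairs [(v, w)] that occur are exactly those with [v != 0],
    [w != 0] and [w v = 0], and GL_n permutes them transitively, so every pair
    comes from the same number [C] of matrices ([card_flag_ends_fibre]).  Hence
    the number of suitable [g] is [C] times the number of pairs which also
    satisfy [w y v = 0] ([card_Hess_pts_incidences]).  The same identity for
    [y = 0], where every [g] is suitable, determines [C] from the order of GL_n.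

    To count the pairs, fix [v].  The covectors killing both [v] and [y v] form
    a space of dimension [n - 1] if [v] is an eigenvector and [n - 2] if it is
    not ([card_annihilator]).  Each of the [k] fixed lines contains [q - 1]
    eigenvectors ([card_eigenvectors]), so there are
    [(q^n - 1) (q^(n-2) - 1) + k (q - 1) (q - 1) q^(n-2)] pairs, that is,
    [(q - 1)^2 ([n]_q [n-2]_q + k q^(n-2))].  What remains after dividing by the
    order of the Borel subgroup is the factor [[n-2]_q!], the number of ways of
    completing [V_1] and [V_(n-1)] to a full flag. *)

Section Counting.

Set Implicit Arguments.
Unset Strict Implicit.
Unset Printing Implicit Defensive.

Import GRing.Theory.
Local Open Scope ring_scope.

Variable F : finFieldType.
Local Notation q := #|F|.

(** * The Borel subgroup *)

(** An upper triangular matrix is invertible exactly when its diagonal has no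
    zero, so its entries can be chosen independently: any scalar above the
    diagonal, a nonzero one on it. *)
Lemma card_borel m : #|borel F m.+1| = (q.-1 ^ m.+1 * q ^ 'C(m.+1, 2))%N.
Proof.
(* The set of scalars allowed at position x. *)
pose D (x : 'I_m.+1 * 'I_m.+1) : {pred F} :=
  if (x.1 < x.2)%N then predT else if x.1 == x.2 then predC1 0 else pred1 0.
pose mx (f : {ffun 'I_m.+1 * 'I_m.+1 -> F}) : 'M[F]_m.+1 :=
  \matrix_(i, j) f (i, j).
have mx_inj : injective mx.
  move=> f g /matrixP eq_fg; apply/ffunP=> -[i j].
  by have := eq_fg i j; rewrite !mxE.
rewrite -(card_imset _ (@val_inj _ _ {'GL_m.+1[F]})) /=.
have -> : [set \val g | g in borel F m.+1] = mx @: [set f in family D].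
  apply/setP=> a; apply/imsetP/imsetP=> [[g] | [f]].
    rewrite inE => gT ->; exists [ffun x => \val g x.1 x.2].
      have g_diag i : \val g i i != 0.
        have := GL_det g; rewrite -det_tr (det_trig gT) => /prodf_neq0/(_ i isT).
        by rewrite mxE.
      rewrite inE; apply/familyP=> -[i j]; rewrite ffunE /D /=.
      case: ltnP => // le_ji; case: eqVneq => [<-|ne_ij]; rewrite inE //.
      have lt_ji : (j < i)%N by rewrite ltn_neqAle eq_sym ne_ij.
      by have := is_trig_mxP gT j i lt_ji; rewrite mxE => /eqP.
    by apply/matrixP=> i j; rewrite !mxE ffunE.
  rewrite inE => /familyP fD ->.
  have aT : is_trig_mx (mx f)^T.
    apply/is_trig_mxP=> i j lt_ij; rewrite !mxE; have := fD (j, i).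
    rewrite /D /= ltnNge (ltnW lt_ij) /=.
    by case: eqVneq lt_ij => [->|_ _]; rewrite ?ltnn // inE => /eqP.
  have aU : mx f \in unitmx.
    rewrite unitmxE -det_tr (det_trig aT) unitfE; apply/prodf_neq0=> i _.
    by have := fD (i, i); rewrite /D /= ltnn eqxx inE !mxE.
  by exists (FinRing.unit _ aU); rewrite ?inE.
rewrite card_imset // cardsE card_family foldrE big_image /=.
rewrite -(pair_bigA _ (fun i j => #|D (i, j)|)) exchange_big /=.
(* Column j has j free entries above the diagonal, and one nonzero entry. *)
have col_prod (j : 'I_m.+1) : (\prod_(i < m.+1) #|D (i, j)| = q.-1 * q ^ j)%N.
  have entry i : #|D (i, j)| =
      ((if i == j then q.-1 else 1) * (if (i < j)%N then q else 1))%N.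
    rewrite /D /=; case: (eqVneq i j) => [->|_]; rewrite ?ltnn ?muln1 ?mul1n.
      by have := cardC1 (0 : F).
    by case: ifP => _; rewrite ?card1.
  rewrite (eq_bigr _ (fun i _ => entry i)) big_split /= -!big_mkcond /=.
  by rewrite big_pred1_eq (big_ord_narrow (ltnW (ltn_ord j))) prod_nat_const card_ord.
rewrite (eq_bigr _ (fun j _ => col_prod j)) big_split /= prod_nat_const card_ord.
by rewrite -expn_sum -bin2_sum big_mkord.
Qed.

(** * From cosets to matrices *)

(** The union of the cosets belonging to the Hessenberg variety of [y]. *)
Definition Hess_pts m (y : 'M[F]_m.+1) : {set {'GL_m.+1[F]}} :=
  [set g : {'GL_m.+1[F]} |
    invmx (GLval g) *m y *m GLval g \in @Hess_max F m.+1].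

(** In the lower left entry of [b^-1 a b] with [b] upper triangular, the only
    term that survives is a multiple of the lower left entry of [a]. *)
Lemma Hess_pts_mulr m (y : 'M[F]_m.+1) g b :
  b \in borel F m.+1 -> g \in Hess_pts y -> (g * b)%g \in Hess_pts y.
Proof.
move=> bB; have := groupVr bB; move: bB.
rewrite !inE => /is_trig_mxP bT /is_trig_mxP bVT /eqP g0.
rewrite -GL_VxE invMg !GL_MxE !GL_VxE in bVT *.
have -> : invmx (GLval b) *m invmx (GLval g) *m y *m (GLval g *m GLval b)
   = invmx (GLval b) *m (invmx (GLval g) *m y *m GLval g) *m GLval b.
  by rewrite !mulmxA.
rewrite mxE big1 // => j _; case: (eqVneq j ord0) => [->|j0]; last first.
  by have := bT ord0 j; rewrite lt0n mxE => ->; rewrite ?mulr0.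
rewrite mxE big1 ?mul0r // => i _; case: (eqVneq i ord_max) => [->|ne_i].
  by rewrite g0 mulr0.
have lt_i : (i < @ord_max m)%N by rewrite ltn_neqAle ne_i -ltnS ltn_ord.
by have := bVT i ord_max lt_i; rewrite mxE => ->; rewrite mul0r.
Qed.

Lemma card_Hess_pts m (y : 'M[F]_m.+1) :
  #|Hess_pts y| = (#|@Hess_variety F m.+1 y (@Hess_max F m.+1)| * #|borel F m.+1|)%N.
Proof.
have -> : @Hess_variety F m.+1 y (@Hess_max F m.+1)
    = [set (g *: borel F m.+1)%g | g in Hess_pts y].
  apply/setP=> C; apply/imsetP/imsetP=> -[g gH ->]; exists g => //.
    by move: gH; rewrite !inE.
  by move: gH; rewrite !inE.
rewrite -sum1_card.
rewrite (partition_big_imset (fun g => g *: borel F m.+1)%g) /= -sum_nat_const.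
apply: eq_bigr => C /imsetP[g gH ->]; rewrite sum1_card -(card_lcoset _ g).
apply: eq_card => h; rewrite -topredE /=.
apply/andP/idP=> [[hH /eqP<-] | hC]; first exact: lcoset_refl.
split; last by rewrite (lcoset_eqP hC).
by case/lcosetP: hC => b bB ->; apply: Hess_pts_mulr.
Qed.


(** * Lines and hyperplanes of the flags *)

(** The first column of [g] and the last row of its inverse, that is, a vector
    spanning the line and an equation of the hyperplane of the flag of [g]. *)
Definition flag_ends m (g : {'GL_m.+1[F]}) : 'cV[F]_m.+1 * 'rV[F]_m.+1 :=
  (GLval g *m delta_mx ord0 0, delta_mx 0 ord_max *m invmx (GLval g)).

(** A generator of a line [V_1] and an equation of a hyperplane [V_(n-1)] such
    that [V_1] and [y V_1] are contained in [V_(n-1)]; a pair is incident for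
    [y = 0] as soon as [V_1] is contained in [V_(n-1)]. *)
Definition incidences m (y : 'M[F]_m.+1) : {set 'cV[F]_m.+1 * 'rV[F]_m.+1} :=
  [set vw | [&& vw.1 != 0, vw.2 != 0, vw.2 *m vw.1 == 0
              & vw.2 *m y *m vw.1 == 0]].

(** Left translation of matrices corresponds to the natural action of GL_n on
    pairs of a vector and a covector. *)
Lemma flag_endsM m (h g : {'GL_m.+1[F]}) :
  flag_ends (h * g)%g
    = (GLval h *m (flag_ends g).1, (flag_ends g).2 *m invmx (GLval h)).
Proof. by rewrite /flag_ends -GL_VxE invMg !GL_MxE !GL_VxE !mulmxA. Qed.

(** The first three conditions of an incidence hold automatically: the vector
    and the covector are nonzero because [g] is invertible, and their product is
    the entry of [g^-1 g = 1] in the last row and first column, which is off the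
    diagonal because the dimension is at least 2. *)
Lemma Hess_pts_flag_ends m (y : 'M[F]_m.+2) (g : {'GL_m.+2[F]}) :
  (g \in Hess_pts y) = (flag_ends g \in incidences y).
Proof.
have gU : GLval g \in unitmx := GL_unitmx g.
have delta0 (n1 n2 : nat) (i : 'I_n1) (j : 'I_n2) : 
    delta_mx i j != 0 :> 'M[F]_(n1, n2).
  by apply/eqP=> /matrixP/(_ i j)/eqP; rewrite !mxE !eqxx oner_eq0.
have -> : (flag_ends g \in incidences y) =
    (delta_mx 0 ord_max *m (invmx (GLval g) *m y *m GLval g)
       *m delta_mx ord0 0 == 0 :> 'M[F]_1).
  rewrite inE /= !mulmxA mulmxKV // mul_delta_mx_0 // eqxx.
  have -> : GLval g *m delta_mx ord0 0 != 0 :> 'cV_m.+2.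
    apply: contra (delta0 m.+2 1%N ord0 0) => /eqP g0.
    by rewrite -(mulKmx gU (delta_mx _ _)) g0 mulmx0.
  have -> : delta_mx 0 ord_max *m invmx (GLval g) != 0 :> 'rV_m.+2.
    apply: contra (delta0 1%N m.+2 0 ord_max) => /eqP g0.
    by rewrite -(mulmxKV gU (delta_mx _ _)) g0 mul0mx.
  by [].
rewrite inE -rowE -colE inE; apply/eqP/eqP=> [a0 | /matrixP/(_ 0 0)].
  by apply/matrixP=> i j; rewrite !mxE in a0 *.
by rewrite !mxE.
Qed.

Lemma unitmx_with_row m (i : 'I_m) (v : 'rV[F]_m) :
  v != 0 -> exists2 g : 'M[F]_m, g \in unitmx & delta_mx 0 i *m g = v.
Proof.
move=> v0; have [|g gU] :=
    @complete_unitmx _ _ _ (delta_mx (0 : 'I_1) i) (delta_mx i 0 *m v).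
  rewrite mulmxA mul_delta_mx [delta_mx 0 0]mx11_scalar mxE mul1mx.
  by rewrite rank_rV v0 mxrank_delta.
by rewrite mulmxA mul_delta_mx [delta_mx 0 0]mx11_scalar mxE mul1mx; exists g.
Qed.

(** Transitivity of GL_n on incident pairs [(v, w)].  First choose [h] with first
    column [v].  Then [w h] vanishes at the first position, because [w v = 0],
    so it is the last row of a matrix [M] made of a block 1 and of an invertible
    block of size [n - 1].  Since [M] fixes the first basis vector, [h M^-1] has
    the required first column, and the last row of its inverse [M h^-1] is
    [w]. *)
Lemma flag_ends_onto m (vw : 'cV[F]_m.+2 * 'rV[F]_m.+2) :
  vw \in incidences 0 -> exists g : {'GL_m.+2[F]}, flag_ends g = vw.
Proof.
case: vw => v w; rewrite inE => /and4P[/= v0 w0 /eqP wv0 _].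
have [|h'] := @unitmx_with_row _ ord0 v^T; first by rewrite trmx_eq0.
rewrite -unitmx_tr; set h := h'^T => hU /(congr1 trmx).
rewrite trmx_mul trmxK trmx_delta -/h => h_e0.
have wh0 : w *m h != 0.
  by apply: contra w0 => /eqP wh0; rewrite -(mulmxK hU w) wh0 mul0mx.
pose w' : 'rV[F]_(1 + m.+1) := w *m h.
have wl0 : lsubmx w' = 0.
  have wh_0 : (w *m h) 0 ord0 = 0.
    have := wv0; rewrite -h_e0 mulmxA -colE => /matrixP/(_ 0 0).
    by rewrite mxE [RHS]mxE.
  apply/matrixP=> i j; rewrite !ord1 [RHS]mxE mxE -[RHS]wh_0.
  by congr (w' _ _); apply: val_inj.
have w'E : w' = row_mx 0 (rsubmx w') by rewrite -wl0 hsubmxK.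
have [|A AU eA] := @unitmx_with_row m.+1 ord_max (rsubmx w').
  by apply: contra wh0 => /eqP wr0; rewrite -/w' w'E wr0 row_mx0.
pose M : 'M[F]_(1 + m.+1) := block_mx 1%:M 0 0 A.
have MU : M \in unitmx by rewrite unitmxE det_ublock det1 mul1r -unitmxE.
have M_e0 : M *m delta_mx ord0 0 = delta_mx ord0 0 :> 'cV_(1 + m.+1).
  have e0 : delta_mx ord0 0 = col_mx 1 0 :> 'cV[F]_(1 + m.+1).
    apply/colP=> i; rewrite !mxE.
    by case: splitP => j; rewrite ?ord1 mxE -!(inj_eq (@ord_inj _)) /= => ->.
  by rewrite e0 mul_block_col !mul0mx !addr0 mulmx0 addr0 mulmx1.
have M_el : (delta_mx 0 ord_max : 'rV_(1 + m.+1)) *m M = w'.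
  have el : delta_mx 0 ord_max = row_mx 0 (delta_mx 0 ord_max) :> 'rV[F]_(1 + m.+1).
    apply/rowP=> i; rewrite !mxE.
    by case: splitP => j; rewrite ?ord1 mxE -!(inj_eq (@ord_inj _)) /= => ->.
  by rewrite el mul_row_block !mul0mx mulmx0 !add0r eA -w'E.
pose gh : {'GL_m.+2[F]} := FinRing.unit _ hU.
pose gM : {'GL_m.+2[F]} := FinRing.unit _ MU.
exists (gh * gM^-1)%g.
rewrite flag_endsM /flag_ends GL_VxE /= invmxK.
rewrite M_el mulmxK //; congr (_, _).
by rewrite -h_e0; congr (_ *m _); rewrite -{1}M_e0 mulKmx.
Qed.

Lemma eq_flag_endsM m (h g1 g2 : {'GL_m.+1[F]}) :
  (flag_ends (h * g1)%g == flag_ends (h * g2)%g) = (flag_ends g1 == flag_ends g2).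
Proof.
have hU : GLval h \in unitmx := GL_unitmx h.
rewrite !flag_endsM; case: (flag_ends g1) (flag_ends g2) => [v1 w1] [v2 w2] /=.
apply/eqP/eqP=> [[eq_v eq_w] | [-> ->] //]; congr (_, _).
  by rewrite -(mulKmx hU v1) eq_v mulKmx.
by rewrite -(mulmxKV hU w1) eq_w mulmxKV.
Qed.

(** By transitivity every fibre is a left translate of the fibre of the identity
    matrix. *)
Lemma card_flag_ends_fibre m (vw : 'cV[F]_m.+2 * 'rV[F]_m.+2) :
  vw \in incidences 0 ->
  #|[set g : {'GL_m.+2[F]} | flag_ends g == vw]|
    = #|[set g : {'GL_m.+2[F]} | flag_ends g == flag_ends 1%g]|.
Proof.
move=> /flag_ends_onto[h <-]; rewrite -[RHS](card_lcoset _ h).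
apply: eq_card => g; rewrite mem_lcoset !inE.
by rewrite -[RHS](eq_flag_endsM h) mulKVg mulg1.
Qed.

(** Since the fibre factor does not involve [y], it can be computed by taking
    [y = 0], for which the left-hand side is the order of GL_n. *)
Lemma card_Hess_pts_incidences m (y : 'M[F]_m.+2) :
  #|Hess_pts y|
    = (#|incidences y| *
       #|[set g : {'GL_m.+2[F]} | flag_ends g == flag_ends 1%g]|)%N.
Proof.
rewrite -sum1_card (partition_big (@flag_ends m.+1) [in incidences y]) /=; last first.
  by move=> g; rewrite Hess_pts_flag_ends.
rewrite -sum_nat_const; apply: eq_bigr => vw vwP.
rewrite sum1_card -(card_flag_ends_fibre (vw := vw)).
  apply: eq_card => g; rewrite inE -topredE /= Hess_pts_flag_ends.
  by case: eqP => [->|]; rewrite ?vwP ?andbF.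
by move: vwP; rewrite !inE mulmx0 mul0mx eqxx => /and4P[-> -> ->].
Qed.


(** * Counting incident pairs *)

(** Eigenvalue 0 is included: a line killed by [y] is fixed. *)
Definition eigenvectors m (y : 'M[F]_m) : {set 'cV[F]_m} :=
  [set v | (v != 0) && (y *m v \in <[v]>%VS)].

(** The covectors killing [v] and [u] form the left kernel of the two-column
    matrix [(v u)], whose rank is 1 or 2 according as [u] is a multiple of [v]
    or not. *)
Lemma card_annihilator m (v u : 'cV[F]_m.+2) : v != 0 ->
  #|[set w : 'rV[F]_m.+2 | (w *m v == 0) && (w *m u == 0)]|
    = (q ^ m * (if u \in <[v]>%VS then q else 1))%N.
Proof.
move=> v0; have vT0 : v^T != 0 by rewrite trmx_eq0.
have -> : [set w : 'rV[F]_m.+2 | (w *m v == 0) && (w *m u == 0)]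
    = rowg (kermx (row_mx v u)).
  apply/setP=> w; rewrite mem_rowg inE; apply/andP/sub_kermxP=> [[/eqP wv /eqP wu]|].
    by rewrite mul_mx_row wv wu row_mx0.
  by rewrite mul_mx_row -row_mx0 => /eq_row_mx[-> ->].
have -> : (u \in <[v]>%VS) = (u^T <= v^T)%MS.
  apply/vlineP/sub_rVP=> -[a e]; exists a; first by rewrite e linearZ.
  by apply: trmx_inj; rewrite e linearZ.
rewrite card_rowg mxrank_ker -mxrank_tr tr_row_mx -addsmxE.
have := mxrank_leqif_sup (addsmxSl v^T u^T); rewrite addsmx_sub submx_refl /=.
rewrite rank_rV vT0 => /leqifP; case: ifP => [_ /eqP<- | _ rk_gt1].
  by rewrite subn1 expnSr.
suff -> : \rank (v^T + u^T)%MS = 2%N by rewrite subn2 muln1.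
apply/eqP; rewrite eqn_leq rk_gt1 andbT.
by rewrite addsmxE rank_leq_row.
Qed.

Lemma predn_expS t n : (0 < t -> (t ^ n.+1).-1 = (t ^ n).-1 + t.-1 * t ^ n)%N.
Proof.
case: t => // t _; rewrite expnS mulSn /=.
by have := expn_gt0 t.+1 n; case: (t.+1 ^ n)%N.
Qed.

(** A vector [v] contributes the [q^(n-2) - 1] nonzero covectors of a space of
    codimension 2, plus [(q - 1) q^(n-2)] more when it is an eigenvector. *)
Lemma card_incidences m (y : 'M[F]_m.+2) :
  #|incidences y|
    = ((q ^ m.+2).-1 * (q ^ m).-1 + #|eigenvectors y| * (q.-1 * q ^ m))%N.
Proof.
have q_gt0 : (0 < q)%N by apply/card_gt0P; exists 0.
pose ann (v : 'cV[F]_m.+2) : {set 'rV[F]_m.+2} :=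
  [set w | (w *m v == 0) && (w *m (y *m v) == 0)].
have ann_card (v : 'cV[F]_m.+2) : v != 0 -> #|ann v :\ 0|
    = ((q ^ m).-1 + if y *m v \in <[v]>%VS then q.-1 * q ^ m else 0)%N.
  move=> v0; have := card_annihilator (y *m v) v0; rewrite -/(ann v).
  rewrite (cardsD1 0) inE !mul0mx eqxx add1n => /(congr1 predn) /= ->.
  case: ifP => _; last by rewrite muln1 addn0.
  by rewrite -expnSr predn_expS.
rewrite -sum1_card (partition_big fst (fun v => v != 0)) /=; last first.
  by case=> v w; rewrite inE => /and4P[].
transitivity (\sum_(v : 'cV[F]_m.+2 | v != 0%R) #|ann v :\ 0%R|)%N.
  apply: eq_bigr => v v0; rewrite sum1_card.
  rewrite -[RHS](card_imset _ (_ : injective (pair v))) => [|w1 w2 [] //].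
  apply: eq_card => -[v1 w]; rewrite -topredE /= inE /=.
  apply/andP/imsetP=> [[/and4P[_ w0 wv wyv] /eqP v1E] | [w1]].
    by subst v1; exists w => //; rewrite !inE w0 wv mulmxA.
  by rewrite !inE mulmxA => /and3P[w0 wv wyv] [-> ->]; rewrite v0 w0 wv eqxx.
rewrite (eq_bigr _ ann_card) big_split /= sum_nat_const.
rewrite -big_mkcondr /= sum_nat_const.
congr (_ * _ + _ * _)%N; last by apply: eq_card => v; rewrite inE.
by have := cardC1 (0 : 'cV[F]_m.+2); rewrite card_mx muln1 => <-.
Qed.

(** The eigenvectors are partitioned by the lines that they span, which are the
    fixed lines, and each line has [q - 1] generators. *)
Lemma card_eigenvectors m k (y : 'M[F]_m.+1) :
  @fixes_exactly F m.+1 y k -> #|eigenvectors y| = (k * q.-1)%N.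
Proof.
case=> s [s_uniq <- sE].
have fixed_vline (v : 'cV[F]_m.+1) :
    (v \in eigenvectors y) = (v != 0) && (<[v]>%VS \in s).
  rewrite sE !inE limg_line -memvE lfunE /= dim_vline.
  by case: (v != 0).
have card_gens (V : {vspace 'cV[F]_m.+1}) : V \in s ->
    #|[set v : 'cV[F]_m.+1 | (v != 0) && (V == <[v]>%VS)]| = q.-1.
  rewrite sE inE => /andP[/eqP dimV _].
  have u0 : vpick V != 0 by rewrite vpick0 -dimv_eq0 dimV.
  have VE : V = <[vpick V]>%VS.
    by apply/esym/eqP; rewrite eqEdim -memvE memv_pick dim_vline u0 dimV.
  move: (vpick V) u0 VE => u u0 ->.
  have scale_inj : injective (fun a : F => a *: u).
    move=> a b /eqP; rewrite -subr_eq0 -scalerBl scaler_eq0 (negPf u0) orbF.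
    by rewrite subr_eq0 => /eqP.
  rewrite -(cardC1 (0 : F)) -(card_imset _ scale_inj).
  apply: eq_card => v; rewrite inE; apply/andP/imsetP=> [[v0 /eqP uv] | [a]].
    have /vlineP[a va] : v \in <[u]>%VS by rewrite uv memv_line.
    exists a => //; rewrite inE.
    by apply: contra v0 => /eqP a0; rewrite va a0 scale0r.
  rewrite inE => a0 ->; rewrite scaler_eq0 negb_or a0 u0; split=> //.
  rewrite eq_sym eqEdim -memvE memvZ ?memv_line // !dim_vline u0.
  by rewrite scaler_eq0 negb_or a0 u0.
(* Double counting of the pairs of a vector and the fixed line it spans. *)
transitivity (\sum_(v : 'cV[F]_m.+1 | v != 0%R) \sum_(V <- s) (V == <[v]>%VS))%N.
  rewrite -sum1_card big_mkcond [RHS]big_mkcond; apply: eq_bigr => v _.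
  rewrite fixed_vline; case: (v != 0) => //=.
  by rewrite -big_mkcond sum1_count /= count_uniq_mem //.
rewrite exchange_big /= (eq_big_seq (fun=> q.-1)) => [|V /card_gens <-].
  by rewrite big_const_seq count_predT iter_addn_0 mulnC.
by rewrite -sum1dep_card big_mkcondr.
Qed.

(** Every nonzero vector is an eigenvector of the zero matrix. *)
Lemma card_incidences0 m :
  #|incidences (0 : 'M[F]_m.+2)| = ((q ^ m.+2).-1 * (q ^ m.+1).-1)%N.
Proof.
have q_gt0 : (0 < q)%N by apply/card_gt0P; exists 0.
rewrite card_incidences.
have -> : #|eigenvectors (0 : 'M[F]_m.+2)| = (q ^ m.+2).-1.
  have := cardC1 (0 : 'cV[F]_m.+2); rewrite card_mx muln1 => <-.
  by apply: eq_card => v; rewrite !inE mul0mx mem0v andbT.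
by rewrite -mulnDr -predn_expS.
Qed.

(** * The quotient by the Borel subgroup *)

Lemma predn_exp_qint n t : (t ^ n).-1 = (t.-1 * qint n t)%N.
Proof. by rewrite predn_exp /qint big_mkord. Qed.

Lemma prod_predn_exp n t :
  (\prod_(1 <= i < n.+1) (t ^ i - 1) = t.-1 ^ n * qfact n t)%N.
Proof.
rewrite /qfact; under eq_bigr do rewrite subn1 predn_exp_qint.
by rewrite big_split /= prod_nat_const_nat subn1.
Qed.

Lemma qfactS n t : qfact n.+1 t = (qfact n t * qint n.+1 t)%N.
Proof. by rewrite /qfact big_nat_recr. Qed.

Lemma qint_gt0 n t : (0 < qint n.+1 t)%N.
Proof. by rewrite /qint big_nat_recl. Qed.

(** Here [r] is [q - 1], [a0], [a1], [a2] are the quantum integers of [n - 2],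
    [n - 1], [n], [f] is the quantum factorial of [n - 2], [P] is [q^(n-2)] and
    [Q] is the power of [q] common to the orders of GL_n and of the Borel
    subgroup.  The first equation, which is the case [y = 0], gives the size [C]
    of the fibres; substituting it into the second one gives the number [X] of
    flags. *)
Lemma flag_count_arith (Q r m f a0 a1 a2 k P C X : nat) :
  (0 < Q)%N -> (0 < r)%N -> (0 < a1)%N -> (0 < a2)%N ->
  (Q * (r ^ m.+2 * (f * a1 * a2)) = r * a2 * (r * a1) * C)%N ->
  ((r * a2 * (r * a0) + k * r * (r * P)) * C = X * (r ^ m.+2 * Q))%N ->
  X = (f * (a2 * a0 + k * P))%N.
Proof.
move=> Q_gt0 r_gt0 a1_gt0 a2_gt0; rewrite !expnS.
have : (0 < r ^ m)%N by rewrite expn_gt0 r_gt0.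
move: (r ^ m)%N => R R_gt0 fibre_eq count_eq.
have CE : C = (Q * (R * f))%N.
  apply/eqP; rewrite -(@eqn_pmul2l (r * a2 * (r * a1))).
    by rewrite -fibre_eq; apply/eqP; ring.
  by rewrite !muln_gt0 r_gt0 a1_gt0 a2_gt0.
apply/eqP; rewrite -(@eqn_pmul2r (r * (r * R) * Q)) ?muln_gt0 ?r_gt0 ?R_gt0 ?Q_gt0 //.
by rewrite -count_eq CE; apply/eqP; ring.
Qed.

Lemma card_Hess_variety_max m k (y : 'M[F]_m.+2) :
  @fixes_exactly F m.+2 y k ->
  #|@Hess_variety F m.+2 y (@Hess_max F m.+2)|
    = (qfact m q * (qint m.+2 q * qint m q + k * q ^ m))%N.
Proof.
move=> hk; have q_gt1 : (1 < q)%N := card_finNzRing_gt1 F.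
set C := #|[set g : {'GL_m.+2[F]} | flag_ends g == flag_ends 1%g]|.
have GL0 : #|'GL_m.+2[F]%g| = (#|incidences (0 : 'M[F]_m.+2)| * C)%N.
  rewrite -card_Hess_pts_incidences; apply: eq_card => g.
  by rewrite [RHS]inE in_setT /Hess_max inE mulmx0 mul0mx mxE eqxx.
have := card_Hess_pts y; rewrite card_Hess_pts_incidences -/C.
rewrite card_incidences (card_eigenvectors hk) card_borel !predn_exp_qint.
move: GL0; rewrite card_GL // prod_predn_exp card_incidences0 !predn_exp_qint.
rewrite !qfactS.
apply: flag_count_arith; rewrite ?qint_gt0 ?expn_gt0 ?(ltnW q_gt1) //.
by rewrite -ltnS prednK // ltnW.
Qed.

End Counting.

Theorem proposition2 (n p k : nat) (hn : 2 <= n) (hp : prime p)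
    (y : 'M['F_p]_n.-1.+1) (hk : fixes_exactly y k) :
  #|Hess_variety y (@Hess_max _ n)|
    = qfact (n - 2) p * (qint n p * qint (n - 2) p + k * p ^ (n - 2)).
Proof.
case: n hn y hk => [|[|m]] // _ y hk.
by rewrite subn2 (card_Hess_variety_max hk) card_Fp.
Qed.
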